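(* Let $L$ be a finite-dimensional Lie algebra over $\mathbb{F}$. Then $L/P(L)$, the factor algebra of $L$ by its perfect radical $P(L)$, is solvable.
   Context: $\mathbb{F}$ denotes either the field of real numbers or the field of complex numbers. An ideal $I$ of a Lie algebra $L$ is called a perfect ideal if $[I,I]=I$, where $[I,I]$ is the linear span of all brackets of elements of $I$; the zero ideal is a perfect ideal. The sum of two perfect ideals is a perfect ideal, so a finite-dimensional Lie algebra $L$ has a largest perfect ideal (one containing all perfect ideals of $L$); it is called the perfect radical of $L$ and denoted $P(L)$. A Lie algebra $M$ is solvable if its derived series $M^{(0)}=M$, $M^{(k+1)}=[M^{(k)},M^{(k)}]$ satisfies $M^{(m)}=0$ for some $m$. *)

(* Defs.v *)
From HB Require Import structures.
From mathcomp Require Import all_boot all_algebra.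
From mathcomp Require Import generic_quotient ring_quotient.
From mathcomp Require Import boolp reals.
From mathcomp Require Export complex.

Set Implicit Arguments.
Unset Strict Implicit.
Unset Printing Implicit Defensive.

Import GRing.Theory.

Local Open Scope ring_scope.
Local Open Scope quotient_scope.

HB.mixin Record Lmodule_isLieAlgebra (F : fieldType) (L : Type)
    of GRing.Lmodule F L := {
  lieb : L -> L -> L;
  lieb_is_linearl : forall y, linear (lieb^~ y);
  lieb_is_linearr : forall x, linear (lieb x);
  liebxx : forall x, lieb x x = 0;
  lieb_jacobi : forall x y z,
    lieb x (lieb y z) + lieb y (lieb z x) + lieb z (lieb x y) = 0
}.

#[short(type="lieAlgType")]
HB.structure Definition LieAlgebra (F : fieldType) :=
  {L of Lmodule_isLieAlgebra F L & GRing.Lmodule F L}.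

#[short(type="vectLieAlgType")]
HB.structure Definition VectLieAlgebra (F : fieldType) :=
  {L of LieAlgebra F L & Vector F L}.

Section Bracket.
Variables (F : fieldType) (L : vectLieAlgType F).
Implicit Types (x y z : L) (U V W : {vspace L}).

Lemma liebPl (a : F) x x' y : lieb (a *: x + x') y = a *: lieb x y + lieb x' y.
Proof. exact: lieb_is_linearl. Qed.

Lemma liebPr (a : F) x y y' : lieb x (a *: y + y') = a *: lieb x y + lieb x y'.
Proof. exact: lieb_is_linearr. Qed.

Lemma lieb0x x : lieb 0 x = 0.
Proof. by have := liebPl (-1) 0 0 x; rewrite scaler0 addr0 scaleN1r addNr. Qed.

Lemma liebx0 x : lieb x 0 = 0.
Proof. by have := liebPr (-1) x 0 0; rewrite scaler0 addr0 scaleN1r addNr. Qed.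

Lemma liebDl x x' y : lieb (x + x') y = lieb x y + lieb x' y.
Proof. by have := liebPl 1 x x' y; rewrite !scale1r. Qed.

Lemma liebDr x y y' : lieb x (y + y') = lieb x y + lieb x y'.
Proof. by have := liebPr 1 x y y'; rewrite !scale1r. Qed.

Lemma liebZl (a : F) x y : lieb (a *: x) y = a *: lieb x y.
Proof. by have := liebPl a x 0 y; rewrite addr0 lieb0x addr0. Qed.

Lemma liebZr (a : F) x y : lieb x (a *: y) = a *: lieb x y.
Proof. by have := liebPr a x y 0; rewrite addr0 liebx0 addr0. Qed.

Lemma liebBl x x' y : lieb (x - x') y = lieb x y - lieb x' y.
Proof. by rewrite liebDl -scaleN1r liebZl scaleN1r. Qed.

Lemma liebBr x y y' : lieb x (y - y') = lieb x y - lieb x y'.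
Proof. by rewrite liebDr -scaleN1r liebZr scaleN1r. Qed.

Lemma liebC x y : lieb y x = - lieb x y.
Proof.
apply/eqP; rewrite -addr_eq0; apply/eqP.
have := liebxx (x + y).
by rewrite liebDl !liebDr !liebxx add0r addr0 addrC.
Qed.

Lemma lieb_suml I (r : seq I) (P : pred I) (f : I -> L) y :
  lieb (\sum_(i <- r | P i) f i) y = \sum_(i <- r | P i) lieb (f i) y.
Proof.
exact: (big_morph (lieb^~ y) (fun u v => liebDl u v y) (lieb0x y)).
Qed.

Lemma lieb_sumr I (r : seq I) (P : pred I) (f : I -> L) x :
  lieb x (\sum_(i <- r | P i) f i) = \sum_(i <- r | P i) lieb x (f i).
Proof. exact: (big_morph (lieb x) (liebDr x) (liebx0 x)). Qed.

(* As for prodv, bases are used because <<_>> spans finite sequences;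
   lie_prodvP and mem_lie_prodvP show that this is the span of all brackets. *)
Definition lie_prodv U V : {vspace L} :=
  <<[seq lieb u v | u <- vbasis U, v <- vbasis V]>>%VS.

Lemma memv_lieb U V x y : x \in U -> y \in V -> lieb x y \in lie_prodv U V.
Proof.
move=> /coord_vbasis-> /coord_vbasis->; rewrite lieb_suml.
apply: memv_suml => i _; rewrite lieb_sumr; apply: memv_suml => j _.
rewrite liebZl liebZr !memvZ // memv_span //.
by apply: allpairs_f; rewrite mem_nth ?size_tuple.
Qed.

Lemma lie_prodvP U V W :
  reflect (forall x y, x \in U -> y \in V -> lieb x y \in W)
          (lie_prodv U V <= W)%VS.
Proof.
apply: (iffP idP) => [/subvP sW x y Ux Vy|sW]; first exact/sW/memv_lieb.
apply/span_subvP=> _ /allpairsP[[u v] /= [Uu Vv ->]].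
by apply: sW; apply: vbasis_mem.
Qed.

Lemma mem_lie_prodvP U V z :
  z \in lie_prodv U V <->
  exists n (c : 'I_n -> F) (x y : 'I_n -> L),
    [/\ forall i, x i \in U, forall i, y i \in V
      & z = \sum_(i < n) c i *: lieb (x i) (y i)].
Proof.
split=> [|[n [c [x [y [Ux Vy ->]]]]]]; last first.
  by apply: memv_suml => i _; rewrite memvZ // memv_lieb.
rewrite /lie_prodv; set s := (X in <<X>>%VS) => /(@coord_span _ _ _ (in_tuple s)).
have sP (i : 'I_(size s)) : exists p : L * L,
    [/\ p.1 \in U, p.2 \in V & s`_i = lieb p.1 p.2].
  have /allpairsP[p [/vbasis_mem Up /vbasis_mem Vp ->]] := mem_nth 0 (ltn_ord i).
  by exists p.
have [p pP] := choice sP => ->.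
exists (size s), (fun i => coord (in_tuple s) i z), (fst \o p), (snd \o p).
split=> [i|i|]; [by have [] := pP i | by have [] := pP i |].
by apply: eq_bigr => i _ /=; have [_ _ ->] := pP i.
Qed.

Fixpoint derived_series (k : nat) : {vspace L} :=
  if k is k'.+1 then lie_prodv (derived_series k') (derived_series k')
  else fullv.

Definition lie_solvable : Prop := exists m, derived_series m = 0%VS.

(* Two-sidedness is automatic by liebC. *)
Definition is_lie_ideal U : Prop := forall x y, y \in U -> lieb x y \in U.

Record lie_ideal := LieIdeal {
  lie_ideal_vs :> {vspace L};
  lie_idealP : is_lie_ideal lie_ideal_vs
}.

Definition lie_perfect (I : lie_ideal) : Prop := lie_prodv I I = I.

Lemma lie_ideal0_subproof : is_lie_ideal 0%VS.
Proof. by move=> x y; rewrite memv0 => /eqP->; rewrite liebx0 mem0v. Qed.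
Definition lie_ideal0 := LieIdeal lie_ideal0_subproof.

Lemma lie_perfect0 : lie_perfect lie_ideal0.
Proof.
apply/eqP; rewrite eqEsubv sub0v andbT; apply/lie_prodvP=> x y _ /=.
by rewrite memv0 => /eqP->; rewrite liebx0 mem0v.
Qed.

Lemma lie_ideal_add_subproof (I J : lie_ideal) : is_lie_ideal (I + J)%VS.
Proof.
move=> x _ /memv_addP[u Iu [v Jv ->]].
by rewrite liebDr memv_add ?lie_idealP.
Qed.
Definition lie_ideal_add I J := LieIdeal (@lie_ideal_add_subproof I J).

Lemma lie_perfect_add I J :
  lie_perfect I -> lie_perfect J -> lie_perfect (lie_ideal_add I J).
Proof.
rewrite /lie_perfect => pI pJ; apply/eqP; rewrite eqEsubv; apply/andP; split.
  by apply/lie_prodvP=> x y _; apply: lie_idealP.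
rewrite subv_add -{1}pI -{1}pJ.
apply/andP; split; apply/lie_prodvP=> x y Ix Iy; apply: memv_lieb.
- exact: subvP (addvSl _ _) _ Ix.
- exact: subvP (addvSl _ _) _ Iy.
- exact: subvP (addvSr _ _) _ Ix.
- exact: subvP (addvSr _ _) _ Iy.
Qed.

Definition is_perfect_radical (P : lie_ideal) : Prop :=
  lie_perfect P /\ forall I : lie_ideal, lie_perfect I -> (I <= P)%VS.

Lemma perfect_radical_exists : exists P, is_perfect_radical P.
Proof.
pose D n := `[< exists2 I : lie_ideal, lie_perfect I & \dim I = n >].
have exD : exists n, D n.
  by exists (\dim lie_ideal0); apply/asboolP; exists lie_ideal0 => //;
     exact: lie_perfect0.
have leD n : D n -> (n <= \dim {:L})%N.
  by move=> /asboolP[I _ <-]; apply/dimvS/subvf.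
have [n /asboolP[P pP dP] maxP] := ex_maxnP exD leD.
exists P; split=> // I pI.
have /eqP : P = lie_ideal_add P I :> {vspace L}.
  apply/eqP; rewrite eqEdim addvSl dP; apply: maxP; apply/asboolP.
  by exists (lie_ideal_add P I) => //; apply: lie_perfect_add.
by move/eqP->; apply: addvSr.
Qed.

Definition perfect_radical : lie_ideal := sval (cid perfect_radical_exists).

Lemma perfect_radicalP : is_perfect_radical perfect_radical.
Proof. exact: svalP (cid perfect_radical_exists). Qed.

Lemma perfect_radical_uniq P :
  is_perfect_radical P -> P = perfect_radical :> {vspace L}.
Proof.
move=> [pP maxP]; have [pR maxR] := perfect_radicalP.
by apply/eqP; rewrite eqEsubv maxR // maxP.
Qed.

End Bracket.

Arguments lie_ideal {F} L.
Arguments perfect_radical {F} L.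
Arguments lie_solvable {F} L.

Section LieQuotient.
Variables (F : fieldType) (L : vectLieAlgType F) (I : lie_ideal L).

Definition lie_quot : Type := Quotient.quot (pred_of_vspace I).

HB.instance Definition _ := GRing.Zmodule.on lie_quot.

Definition lie_pi (x : L) : lie_quot := \pi_(Quotient.quot (pred_of_vspace I)) x.
Definition lie_repr (a : lie_quot) : L := @repr _ (Quotient.quot (pred_of_vspace I)) a.

Lemma lie_reprK : cancel lie_repr lie_pi. Proof. exact: reprK. Qed.

Lemma lie_pi_eqE x y : (lie_pi x = lie_pi y) <-> x - y \in I.
Proof.
by rewrite [_ \in _](Quotient.idealrBE (pred_of_vspace I)); split=> [/eqP|/eqP].
Qed.

Lemma lie_piB : zmod_morphism lie_pi.
Proof. exact: (pi_is_zmod_morphism (Quotient.quot (pred_of_vspace I))). Qed.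
HB.instance Definition _ := GRing.isZmodMorphism.Build L lie_quot lie_pi lie_piB.

Definition lie_quot_scale (a : F) (u : lie_quot) := lie_pi (a *: lie_repr u).
Definition lie_quot_lieb (u v : lie_quot) :=
  lie_pi (lieb (lie_repr u) (lie_repr v)).

Lemma lie_repr_pi x : lie_repr (lie_pi x) - x \in I.
Proof. by apply/lie_pi_eqE; rewrite lie_reprK. Qed.

Fact lie_pi_scale_subproof a x : lie_quot_scale a (lie_pi x) = lie_pi (a *: x).
Proof. by apply/lie_pi_eqE; rewrite -scalerBr memvZ ?lie_repr_pi. Qed.

Fact lie_quot_scaleA a b u :
  lie_quot_scale a (lie_quot_scale b u) = lie_quot_scale (a * b) u.
Proof. by rewrite -[u]lie_reprK !lie_pi_scale_subproof scalerA. Qed.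
Fact lie_quot_scale1 : left_id 1 lie_quot_scale.
Proof. by move=> u; rewrite -[u]lie_reprK lie_pi_scale_subproof scale1r. Qed.
Fact lie_quot_scaleDr : right_distributive lie_quot_scale +%R.
Proof.
move=> a u v; rewrite -[u]lie_reprK -[v]lie_reprK -raddfD.
by rewrite !lie_pi_scale_subproof scalerDr raddfD.
Qed.
Fact lie_quot_scaleDl u :
  {morph lie_quot_scale^~ u : a b / a + b}.
Proof.
by move=> a b; rewrite -[u]lie_reprK !lie_pi_scale_subproof scalerDl raddfD.
Qed.

HB.instance Definition _ := GRing.Zmodule_isLmodule.Build F lie_quot
  lie_quot_scaleA lie_quot_scale1 lie_quot_scaleDr lie_quot_scaleDl.

Lemma lie_piZ : scalable lie_pi.
Proof. by move=> a x; rewrite -lie_pi_scale_subproof. Qed.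
HB.instance Definition _ := GRing.isScalable.Build F L lie_quot *:%R lie_pi lie_piZ.

Fact lie_pi_lieb_subproof x y :
  lie_quot_lieb (lie_pi x) (lie_pi y) = lie_pi (lieb x y).
Proof.
apply/lie_pi_eqE; set x' := lie_repr _; set y' := lie_repr _.
have -> : lieb x' y' - lieb x y = - lieb y' (x' - x) + lieb x (y' - y).
  by rewrite -(liebC y') liebBl liebBr addrA subrK.
by rewrite memvD ?memvN ?lie_idealP ?lie_repr_pi.
Qed.

Fact lie_quot_lieb_linearl v : linear (lie_quot_lieb^~ v).
Proof.
move=> a u u' /=; rewrite -[u]lie_reprK -[u']lie_reprK -[v]lie_reprK -linearP.
by rewrite !lie_pi_lieb_subproof liebPl linearP.
Qed.
Fact lie_quot_lieb_linearr u : linear (lie_quot_lieb u).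
Proof.
move=> a v v' /=; rewrite -[u]lie_reprK -[v]lie_reprK -[v']lie_reprK -linearP.
by rewrite !lie_pi_lieb_subproof liebPr linearP.
Qed.
Fact lie_quot_liebxx u : lie_quot_lieb u u = 0.
Proof. by rewrite -[u]lie_reprK lie_pi_lieb_subproof liebxx raddf0. Qed.
Fact lie_quot_jacobi u v w :
  lie_quot_lieb u (lie_quot_lieb v w) + lie_quot_lieb v (lie_quot_lieb w u)
  + lie_quot_lieb w (lie_quot_lieb u v) = 0.
Proof.
rewrite -[u]lie_reprK -[v]lie_reprK -[w]lie_reprK !lie_pi_lieb_subproof.
by rewrite -!raddfD lieb_jacobi raddf0.
Qed.

HB.instance Definition _ := Lmodule_isLieAlgebra.Build F lie_quot
  lie_quot_lieb_linearl lie_quot_lieb_linearr lie_quot_liebxx lie_quot_jacobi.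

Lemma lie_pi_lieb x y : lie_pi (lieb x y) = lieb (lie_pi x) (lie_pi y).
Proof. by rewrite -lie_pi_lieb_subproof. Qed.

(* L / I is finite-dimensional: it is linearly isomorphic, by projection
   along I, to a complement of I in L. *)
Let C := (I^C)%VS.

Definition lie_quot_v2r (u : lie_quot) : 'rV[F]_(\dim C) :=
  \row_i coord (vbasis C) i (daddv_pi C I (lie_repr u)).

Fact lie_quot_finDim : Vector.axiom (\dim C) lie_quot.
Proof.
have capCI : (C :&: I = 0)%VS by rewrite capvC capv_compl.
have addCI : (C + I = fullv)%VS by rewrite addvC addv_complf.
have pi0 x : x \in I -> daddv_pi C I x = 0.
  move=> Ix; have := daddv_pi_add capCI (subvP (addvSr C I) _ Ix).
  have IC0 : (I :&: C = 0)%VS by rewrite capv_compl.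
  by rewrite (daddv_pi_id IC0 Ix) => /(canRL (addrK _)); rewrite subrr.
have v2rE x : lie_quot_v2r (lie_pi x)
            = \row_i coord (vbasis C) i (daddv_pi C I x).
  apply/rowP=> i; rewrite !mxE; congr (coord (vbasis C) i _).
  by apply/eqP; rewrite -subr_eq0 -[_ - _]linearB; apply/eqP/pi0/lie_repr_pi.
exists lie_quot_v2r.
  move=> a u v; rewrite -[u]lie_reprK -[v]lie_reprK -linearP !v2rE.
  by apply/rowP=> i; rewrite !mxE linearP /= linearP.
exists (fun r : 'rV_(\dim C) => lie_pi (\sum_i r 0 i *: (vbasis C)`_i)) => [u|r].
  rewrite -[u]lie_reprK v2rE; set x := lie_repr u; apply/lie_pi_eqE.
  under eq_bigr => i _ do rewrite mxE.
  rewrite -coord_vbasis ?memv_pi // -{2}[x](daddv_pi_add capCI) ?addCI ?memvf //.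
  by rewrite opprD addNKr memvN memv_pi.
rewrite v2rE daddv_pi_id //; last first.
  by apply: memv_suml => i _; rewrite memvZ // vbasis_mem // mem_nth ?size_tuple.
by apply/rowP=> i; rewrite mxE coord_sum_free // (basis_free (vbasisP C)).
Qed.

HB.instance Definition _ := Lmodule_hasFinDim.Build F lie_quot lie_quot_finDim.

End LieQuotient.

(* Main.v *)
Require Import Defs.
From mathcomp Require Import all_boot all_algebra.
From mathcomp Require Import boolp reals complex.

(** The derived series of [L] consists of ideals and is decreasing, so by finite
dimension it stabilizes: some term [D] satisfies [[D, D] = D]
([derived_series_stabilizes]). Such a [D] is a perfect ideal, hence contained in
the perfect radical [P], and is therefore killed by the projection onto [L / P].
Since every term of the derived series of the quotient is contained in the
projection of the corresponding term for [L] ([derived_series_quot]), the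
derived series of [L / P] reaches zero.

The argument works over every field, which yields the real and the complex case
simultaneously ([lie_quot_perfect_radical_solvable]). *)

Import GRing.Theory.

Section DerivedSeries.
Local Open Scope ring_scope.
Variables (F : fieldType) (L : vectLieAlgType F).
Implicit Types (x y : L) (U V : {vspace L}).

(** The Jacobi identity, in the form that makes [ad x] a derivation. *)
Lemma lieb_derivation x y z :
  lieb x (lieb y z) = lieb (lieb x y) z + lieb y (lieb x z).
Proof.
have := lieb_jacobi x y z.
rewrite (liebC (lieb x y) z) (liebC x z) -scaleN1r liebZr scaleN1r.
by rewrite -addrA -opprD => /subr0_eq->; rewrite addrC.
Qed.

Lemma lie_ideal_prodv U V :
  is_lie_ideal U -> is_lie_ideal V -> is_lie_ideal (lie_prodv U V).
Proof.
move=> idU idV x _ /mem_lie_prodvP[n [c [u [v [Uu Vv ->]]]]].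
rewrite lieb_sumr; apply: memv_suml => i _; rewrite liebZr memvZ //.
by rewrite lieb_derivation memvD // memv_lieb // ?idU ?idV.
Qed.

Lemma derived_series_ideal k : is_lie_ideal (derived_series L k).
Proof.
elim: k => [|k IHk]; last exact: lie_ideal_prodv.
by move=> x y _; apply: memvf.
Qed.

Lemma derived_series_decr k :
  (derived_series L k.+1 <= derived_series L k)%VS.
Proof. by apply/lie_prodvP => x y _; apply: derived_series_ideal. Qed.

(** A term of least dimension must equal its successor, which it contains. *)
Lemma derived_series_stabilizes :
  exists k, derived_series L k.+1 = derived_series L k.
Proof.
pose D n := `[< exists k, \dim (derived_series L k) = n >].
have exD : exists n, D n.
  by exists (\dim (derived_series L 0)); apply/asboolP; exists 0.
have [_ /asboolP[k <-] minD] := ex_minnP exD.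
exists k; apply/eqP; rewrite eqEdim derived_series_decr /=.
by apply: minD; apply/asboolP; exists k.+1.
Qed.

Lemma derived_series_quot (I : lie_ideal L) k :
  (derived_series (lie_quot I) k <= linfun (lie_pi I) @: derived_series L k)%VS.
Proof.
elim: k => [|k /subvP IHk] /=.
  apply/subvP => u _; apply/memv_imgP; exists (lie_repr u); first exact: memvf.
  by rewrite lfunE /= lie_reprK.
apply/lie_prodvP => _ _ /IHk/memv_imgP[x Dx ->] /IHk/memv_imgP[y Dy ->].
by rewrite !lfunE /= -lie_pi_lieb -lfunE memv_img ?memv_lieb.
Qed.

Lemma lie_quot_solvable (I : lie_ideal L) k :
  (derived_series L k <= I)%VS -> lie_solvable (lie_quot I).
Proof.
move=> /subvP DI; exists k; apply/eqP; rewrite -subv0.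
apply: subv_trans (derived_series_quot I k) _.
apply/subvP => _ /memv_imgP[x /DI Ix ->]; rewrite memv0 lfunE /=.
by rewrite -(raddf0 (lie_pi I)); apply/eqP/lie_pi_eqE; rewrite subr0.
Qed.

Lemma lie_quot_perfect_radical_solvable :
  lie_solvable (lie_quot (perfect_radical L)).
Proof.
have [k stabD] := derived_series_stabilizes; apply: (lie_quot_solvable _ k).
have [_ maxP] := perfect_radicalP L.
exact: (maxP (LieIdeal (derived_series_ideal k))).
Qed.

End DerivedSeries.

Theorem proposition2p5 (R : realType) :
  (forall L : vectLieAlgType R, lie_solvable (lie_quot (perfect_radical L))) /\
  (forall L : vectLieAlgType R[i], lie_solvable (lie_quot (perfect_radical L))).
Proof. by split=> L; apply: lie_quot_perfect_radical_solvable. Qed.
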